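(* Let $\Bbbk$ be a perfect field, let $\mathbf{A}$ be an algebra over $\Bbbk$ with unit $1$, and let $A\in\mathbf{A}$ be algebraic over $\Bbbk$ with minimal polynomial $p\in\Bbbk[x]$. Let $\lambda_0,\ldots,\lambda_{n-1}$ be the distinct roots of $p$ in the algebraic closure $\overline{\Bbbk}$, with respective multiplicities $k_0,\ldots,k_{n-1}$, and put $m=m(p)=\max\{k_0,\ldots,k_{n-1}\}$. Then the semi-simple part $S_A$ of the Jordan decomposition of $A$ is given by $S_A=r(A)$, where $r$ is the polynomial $$r(x)=\sum_{j=0}^{n-1}X_j\Lambda_j^{-1}A_j\in\Bbbk[x],$$ with $X_j=\left[L_j(x),\ \frac{(x-\lambda_j)}{1!}L_j(x),\ \ldots,\ \frac{(x-\lambda_j)^{m-1}}{(m-1)!}L_j(x)\right]$ and $A_j=[\lambda_j,0,\ldots,0]^T$ (a column vector of length $m$).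
   Context: Jordan decomposition: for each algebraic $A\in\mathbf{A}$ there exist unique $S_A,N_A\in\Bbbk[A]$ (the subalgebra generated by $A$) such that $A=S_A+N_A$, $S_A$ is semi-simple (its minimal polynomial over the perfect field $\Bbbk$ is separable, i.e. has no multiple roots in $\overline{\Bbbk}$), and $N_A$ is nilpotent; $S_A$ is called the semi-simple part of $A$. For $0\le k\le n-1$, $$L_k(x)=\prod_{\substack{i=0\\ i\ne k}}^{n-1}\frac{(x-\lambda_i)^{m}}{(\lambda_k-\lambda_i)^{m}}\in\overline{\Bbbk}[x],$$ and $\Lambda_k=[l_{ij}]_{0\le i,j\le m-1}\in\overline{\Bbbk}^{m\times m}$ is the lower triangular (invertible) matrix with $l_{ij}=\binom{i}{j}L_k^{(i-j)}(\lambda_k)$ if $j\le i$ and $l_{ij}=0$ if $i<j$, where $L_k^{(s)}$ is the $s$-th (formal) derivative.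
   Formalization: The formal theorem additionally assumes that (m-1)! is nonzero in the field (characteristic 0 or at least m), since otherwise the coefficients 1/1!, ..., 1/(m-1)! in X_j are undefined. *)

(* Defs.v *)
From HB Require Import structures.
From mathcomp Require Import all_boot all_order all_algebra all_field.

Set Implicit Arguments.
Unset Strict Implicit.
Unset Printing Implicit Defensive.

Import GRing.Theory.
Local Open Scope ring_scope.

Definition perfect_field (k : fieldType) : Prop :=
  forall q : {poly k}, irreducible_poly q -> separable_poly q.

Definition is_algebraic_closure (k : fieldType) (kbar : closedFieldType)
    (iota : {rmorphism k -> kbar}) : Prop :=
  forall x : kbar, algebraicOver iota x.

Definition algebraic_elt (k : fieldType) (A : algType k) (a : A) : Prop :=
  exists2 q : {poly k}, q != 0 & horner_alg a q = 0.

Definition is_minimal_poly (k : fieldType) (A : algType k) (a : A)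
    (p : {poly k}) : Prop :=
  [/\ p \is monic, horner_alg a p = 0 &
      forall q : {poly k}, q != 0 -> horner_alg a q = 0 ->
        (size p <= size q)%N].

Definition in_generated_subalg (k : fieldType) (A : algType k) (a b : A) :
    Prop :=
  exists q : {poly k}, b = horner_alg a q.

Definition semisimple_elt (k : fieldType) (A : algType k) (a : A) : Prop :=
  exists2 q : {poly k}, is_minimal_poly a q & separable_poly q.

Definition nilpotent_elt (k : fieldType) (A : algType k) (a : A) : Prop :=
  exists d : nat, a ^+ d = 0.

Definition is_jordan_decomposition (k : fieldType) (A : algType k)
    (a s t : A) : Prop :=
  [/\ in_generated_subalg a s, in_generated_subalg a t, a = s + t,
      semisimple_elt s & nilpotent_elt t].

Definition is_semisimple_part (k : fieldType) (A : algType k) (a s : A) :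
    Prop :=
  exists t : A, is_jordan_decomposition a s t.

Section Formula.

Variables (K : fieldType) (n m : nat) (lambda : 'I_n -> K).

Definition Lpoly (l : 'I_n) : {poly K} :=
  \prod_(i < n | i != l)
    (((lambda l - lambda i) ^+ m)^-1 *: ('X - (lambda i)%:P) ^+ m).

Definition Lambda_mx (l : 'I_n) : 'M[K]_m :=
  \matrix_(i < m, j < m)
    (if (j <= i)%N then 'C(i, j)%:R * ((Lpoly l)^`(i - j)).[lambda l] else 0).

(* Since 0^-1 = 0 here, the coefficients 1/i! have their intended meaning only
   when (m-1)! is nonzero in K. *)
Definition X_row (l : 'I_n) : 'rV[{poly K}]_m :=
  \row_(i < m) (i`!%:R^-1 *: ('X - (lambda l)%:P) ^+ i * Lpoly l).

Definition A_col (l : 'I_n) : 'cV[K]_m :=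
  \col_(i < m) (if i == 0%N :> nat then lambda l else 0).

(* The scalar matrices are embedded entrywise as constant polynomials; the
   product is a 1 x 1 matrix, of which the unique entry is taken. *)
Definition rpoly : {poly K} :=
  \sum_(l < n) (X_row l *m map_mx polyC (invmx (Lambda_mx l))
                        *m map_mx polyC (A_col l)) 0 0.

End Formula.

(* [separable_poly] is the library's gcd criterion; over an algebraically
   closed extension it says that there is no multiple root. *)
Lemma separable_polyE (k : fieldType) (kbar : closedFieldType)
    (iota : {rmorphism k -> kbar}) (q : {poly k}) : q != 0 ->
  separable_poly q <-> forall x : kbar, (mup x (map_poly iota q) <= 1)%N.
Proof.
move=> q0; rewrite -(separable_map iota).
have Q0 : map_poly iota q != 0 by rewrite map_poly_eq0.
move: (map_poly iota q) Q0 => Q Q0; split=> [sepQ x | simple].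
  rewrite leqNgt mup_geq // expr2; apply/negP => dvdQ.
  by have := separable_nosquare sepQ (isT : (1 < 2)%N);
     move=> /(_ ('X - x%:P)); rewrite size_XsubC expr2 dvdQ => /(_ isT).
rewrite unlock; apply/negPn/negP => /closed_rootP[x].
rewrite root_gcd => /andP[/factor_theorem[s Qs]].
rewrite Qs derivM derivXsubC mulr1 rootE !hornerE subrr mulr0 add0r.
move=> /eqP sx0; have /factor_theorem[t st] : root s x by rewrite rootE sx0.
have := simple x; rewrite leqNgt mup_geq // expr2 Qs st -mulrA.
by rewrite dvdp_mull.
Qed.

(* Main.v *)
Require Import Defs.
From Stdlib Require Import Classical.
From HB Require Import structures.
From mathcomp Require Import all_boot all_order all_algebra all_field.
From mathcomp Require Import ring.

Set Implicit Arguments.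
Unset Strict Implicit.
Unset Printing Implicit Defensive.

Import GRing.Theory.
Local Open Scope ring_scope.

(* Let p0 be the separable radical of p over k.  Newton's iteration yields r
   in k[x] with p0 | r - x and p0^m | p0(r); reducing r modulo p0^m, we get
   deg r < n m.  Since p0 is separable, (x - lambda_l)^m | p0(r) forces
   r = lambda_l modulo (x - lambda_l)^m for every l, and these congruences,
   which the explicit formula satisfies by Taylor expansion at lambda_l,
   determine r.  So the formula has coefficients in k without any Galois
   descent, and the same congruences modulo the primary factors of p give the
   uniqueness of the semisimple part. *)

(** * Annihilating polynomials and the separable radical *)

Lemma horner_alg_comp (k : fieldType) (A : algType k) (a : A)
    (p q : {poly k}) :
  horner_alg a (p \Po q) = horner_alg (horner_alg a q) p.
Proof.
elim/poly_ind: p => [|p c IHp]; first by rewrite comp_poly0 !rmorph0.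
by rewrite comp_polyD comp_polyM comp_polyX comp_polyC !rmorphD !rmorphM /=
  IHp !horner_algC horner_algX.
Qed.

Lemma horner_alg_dvd (k : fieldType) (A : algType k) (a : A)
    (p q : {poly k}) :
  horner_alg a p = 0 -> p %| q -> horner_alg a q = 0.
Proof. by move=> pa0 /dvdpP[u ->]; rewrite rmorphM /= pa0 mulr0. Qed.

Lemma minimal_poly_dvd (k : fieldType) (A : algType k) (a : A)
    (p q : {poly k}) :
  is_minimal_poly a p -> horner_alg a q = 0 -> p %| q.
Proof.
move=> [p_monic pa0 p_min] qa0; apply/negPn/negP => ndvd.
have p0 := monic_neq0 p_monic.
have : horner_alg a (q %% p) = 0.
  have := congr1 (horner_alg a) (divp_eq q p).
  by rewrite qa0 rmorphD rmorphM /= pa0 mulr0 add0r.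
by move=> /(p_min _ ndvd); rewrite leqNgt ltn_modp p0.
Qed.

(** Classical descent on the size of an annihilating polynomial, then division by the leading
    coefficient. *)
Lemma minimal_poly_exists (k : fieldType) (A : algType k) (a : A) :
  algebraic_elt a -> exists p, is_minimal_poly a p.
Proof.
move=> [q q0 qa0]; have [d] := ubnP (size q).
elim: d q q0 qa0 => // d IHd q q0 qa0 szq.
case: (classic (exists u, [/\ u != 0, horner_alg a u = 0 &
    (size u < size q)%N])) => [[u [u0 ua0 szu]]|min].
  by apply: (IHd u) => //; apply: leq_trans szu _.
have lc0 : (lead_coef q)^-1 != 0 by rewrite invr_eq0 lead_coef_eq0.
exists ((lead_coef q)^-1 *: q); split.
- by rewrite monicE lead_coefZ mulVf ?lead_coef_eq0.
- by rewrite -mul_polyC rmorphM /= qa0 mulr0.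
move=> u u0 ua0; rewrite size_scale // leqNgt.
by apply/negP => szu; apply: min; exists u.
Qed.

(** Induction on the size: an irreducible [p] is its own radical by perfectness, and for a proper
    factorization the least common multiple of the radicals of the two factors works. *)
Lemma perfect_radical (k : fieldType) (p : {poly k}) :
  perfect_field k -> p != 0 ->
  exists q N, [/\ separable_poly q, q %| p & p %| q ^+ N].
Proof.
move=> k_perfect; have [d] := ubnP (size p).
elim: d p => // d IHd p szp p0.
have [szp1|szp1] := leqP (size p) 1.
  exists 1, 0%N; rewrite dvd1p expr0 dvdp1; split => //.
    by rewrite unlock coprime1p.
  by rewrite eqn_leq szp1 size_poly_gt0.
case: (classic (irreducible_poly p)) => [/k_perfect sep_p|nirr].
  by exists p, 1%N; rewrite expr1 dvdpp.
have [u [v [puv szu szv]]] : exists u v,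
    [/\ p = u * v, (size u < size p)%N & (size v < size p)%N].
  apply: NNPP => nex; apply: nirr; split=> // u szu1 /dvdpP[v pvu].
  have [v0 u0] : v != 0 /\ u != 0.
    by apply/andP; rewrite -negb_or -mulf_eq0 -pvu.
  have [szv1|szv1] := leqP (size v) 1.
    rewrite pvu; move: szv1; rewrite leq_eqVlt ltnS leqn0 size_poly_eq0.
    rewrite (negPf v0) orbF => /size_poly1P[c c0 ->].
    by rewrite mul_polyC eqp_sym eqp_scale.
  have {}szu1 : (1 < size u)%N by rewrite ltn_neqAle eq_sym szu1 size_poly_gt0.
  case: nex; exists v, u; rewrite pvu size_mul // -(subnKC szu1) -(subnKC szv1).
  by rewrite !addSn !addnS /= !ltnS leq_addr leq_addl.
have [u0 v0] : u != 0 /\ v != 0.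
  by apply/andP; rewrite -negb_or -mulf_eq0 -puv.
have [u1 [M [sepu u1u uM]]] := IHd u (leq_trans szu szp) u0.
have [v1 [N [sepv v1v vN]]] := IHd v (leq_trans szv szp) v0.
(* [u1 * w] is the least common multiple of [u1] and [v1]. Separability of [v1 = w * g] makes [w]
   coprime to [g], hence to [u1]. *)
pose g := gcdp u1 v1; pose w := v1 %/ g.
have v1E : v1 = w * g by rewrite divpK // dvdp_gcdr.
exists (u1 * w), (M + N)%N; split.
- rewrite separable_mul sepu (dvdp_separable _ sepv) /=; last first.
    by rewrite {1}v1E dvdp_mulr.
  have cwg : coprimep w g by apply: separable_coprime sepv _; rewrite -v1E.
  apply/coprimepP => e eu ew; move/coprimepP: cwg; apply=> //.
  by rewrite dvdp_gcd eu {1}v1E dvdp_mulr.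
- by rewrite puv dvdp_mul // (dvdp_trans _ v1v) // {1}v1E dvdp_mulr.
rewrite puv exprD dvdp_mul // ?(dvdp_trans uM) ?(dvdp_trans vN) // dvdp_exp2r //.
  by rewrite dvdp_mulr.
by rewrite {1}v1E mulrC dvdp_mul // dvdp_gcdl.
Qed.

(** * Newton's iteration modulo a separable polynomial *)

Lemma comp_polyB_dvd (F : fieldType) (q u v : {poly F}) :
  u - v %| (q \Po u) - (q \Po v).
Proof.
elim/poly_ind: q => [|q c IHq]; first by rewrite !comp_poly0 subr0 dvdp0.
rewrite !comp_polyD !comp_polyM !comp_polyX !comp_polyC.
rewrite opprD addrACA subrr addr0.
have -> : (q \Po u) * u - (q \Po v) * v
    = ((q \Po u) - (q \Po v)) * u + (q \Po v) * (u - v).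
  by rewrite mulrBl mulrBr addrA subrK.
by apply: dvdp_add; [apply: dvdp_mulr | apply: dvdp_mull].
Qed.

(** The remainder [w] is built by induction without dividing by 2, so the expansion holds in every
    characteristic. *)
Lemma comp_poly_taylor2 (F : fieldType) (q u e : {poly F}) :
  exists w, q \Po (u + e) = (q \Po u) + (q^`() \Po u) * e + e ^+ 2 * w.
Proof.
elim/poly_ind: q => [|q c [w IHq]].
  by exists 0; rewrite deriv0 !comp_poly0 mulr0 mul0r !addr0.
exists ((q^`() \Po u) + w * (u + e)).
rewrite derivD derivM derivX derivC mulr1 addr0.
rewrite !comp_polyD !comp_polyM !comp_polyX !comp_polyC IHq.
by ring.
Qed.

(* Newton's iteration for the root 'X of q modulo q. *)
Lemma separable_hensel (F : fieldType) (q : {poly F}) (N : nat) :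
  separable_poly q -> exists r, q %| r - 'X /\ q ^+ N %| (q \Po r).
Proof.
move=> sepq; elim: N => [|N [r [rX rN]]].
  by exists 'X; rewrite subrr dvdp0 expr0 dvd1p.
(* Exponent 1 is treated apart: the Newton step needs [q] itself to divide [q \Po r]. *)
case: N rN => [_|N rN]; first by exists 'X; rewrite subrr dvdp0 comp_polyXr.
(* [u] inverts the derivative of [q] modulo [q]; the Bezout relation holds up to a scalar and is
   rescaled. *)
have [[v u] /= uvE] : exists v, v.1 * q + v.2 * q^`() = 1.
  move: sepq; rewrite unlock => /Bezout_coprimepP[[v u] /= /eqpP[[c d] /=]].
  move=> /andP[c0 d0] E; exists ((d^-1 * c) *: v, (d^-1 * c) *: u) => /=.
  by rewrite -!scalerAl -scalerDr -scalerA E scalerA mulVf // scale1r.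
have qr : q %| (q \Po r) by apply: dvdp_trans rN; rewrite dvdp_exp.
have [w taylor] := comp_poly_taylor2 q r (- (u * (q \Po r))).
exists (r - u * (q \Po r)); split.
  by rewrite addrAC dvdp_addl // dvdpNr dvdp_mull.
(* By Taylor and Bezout the new value is the old one times a multiple of [q], so the exponent grows
   by one. *)
have -> : q \Po (r - u * (q \Po r)) = (q \Po r) *
    (v * q - u * ((q^`() \Po r) - (q^`() \Po 'X)) + u ^+ 2 * (q \Po r) * w).
  by rewrite taylor comp_polyXr -[X in X + _ + _]mulr1 -uvE; ring.
rewrite exprSr; apply: dvdp_mul => //; apply: dvdp_add; last first.
  by apply: dvdp_mulr; apply: dvdp_mull.
apply: dvdp_sub; first exact: dvdp_mull.
by apply: dvdp_mull; apply: dvdp_trans rX _; apply: comp_polyB_dvd.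
Qed.

(** * Congruences at the roots and Taylor coefficients *)

(** For [N > 0], [f.[x]] is a simple root of [q], so the cofactor [q1 \Po f] does not vanish at [x]
    and the whole power divides the linear factor. *)
Lemma separable_comp_dvd (F : fieldType) (q f : {poly F}) (x : F) (N : nat) :
  separable_poly q -> ('X - x%:P) ^+ N %| (q \Po f) ->
  ('X - x%:P) ^+ N %| f - f.[x]%:P.
Proof.
case: N => [|N] sepq; first by rewrite !dvd1p.
move=> dvd_qf; have : root (q \Po f) x.
  by rewrite -dvdp_XsubCl (dvdp_trans _ dvd_qf) // dvdp_exp.
rewrite rootE horner_comp => /factor_theorem[q1 qE].
move: sepq dvd_qf; rewrite qE separable_root => /andP[_ q1x].
rewrite comp_polyM comp_polyB comp_polyX comp_polyC Gauss_dvdpr //.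
by rewrite coprimep_expl // coprimep_sym coprimep_XsubC rootE horner_comp.
Qed.

(** Split off the full power of one root, coprime to its cofactor, and induct on the size. *)
Lemma dvdp_local (F : closedFieldType) (p q : {poly F}) : p != 0 ->
  (forall x N, ('X - x%:P) ^+ N.+1 %| p -> ('X - x%:P) ^+ N.+1 %| q) -> p %| q.
Proof.
have [d] := ubnP (size p); elim: d p => // d IHd p szp p0 loc.
have [szp1|szp1] := eqVneq (size p) 1%N.
  by have := szp1; move/eqP; rewrite -dvdp1 => /dvdp_trans->; rewrite ?dvd1p.
have [x rx] := closed_rootP p szp1.
have [[|N] [u /implyP ux pE]] := multiplicity_XsubC p x.
  by move: (ux p0); rewrite pE expr0 mulr1 in rx *; rewrite rx.
have u0 : u != 0 by apply: contraNneq p0 => u0; rewrite pE u0 mul0r.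
rewrite pE Gauss_dvdp; last first.
  by rewrite coprimep_expr // coprimep_XsubC ux.
rewrite loc ?andbT; last by rewrite pE dvdp_mull.
apply: IHd => //.
  apply: leq_trans (_ : (size u < size p)%N) szp; rewrite pE size_mul ?size_exp_XsubC //.
    by rewrite !addnS ltnS leq_addr.
  by rewrite expf_neq0 // polyXsubC_eq0.
by move=> y M yM; apply: loc; rewrite pE dvdp_mulr.
Qed.

Lemma coprime_prod_dvdp (F : fieldType) (I : finType) (f : I -> {poly F})
    (q : {poly F}) :
  (forall i j, i != j -> coprimep (f i) (f j)) -> (forall i, f i %| q) ->
  \prod_i f i %| q.
Proof.
move=> cop dvd; rewrite -big_enum /=.
elim: (enum I) (enum_uniq I) => [|i s IHs] /=; first by rewrite big_nil dvd1p.
case/andP=> i_s uniq_s; rewrite big_cons Gauss_dvdp ?dvd ?IHs //.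
rewrite big_seq; elim/big_ind: _ => [|u v|j j_s].
- exact: coprimep1.
- by rewrite coprimepMr => -> ->.
by apply: cop; apply: contraNneq i_s => ->.
Qed.

(** Taylor's formula with divided derivatives, valid in every characteristic. *)
Lemma coef_comp_XaddC (F : fieldType) (p : {poly F}) (c : F) (i : nat) :
  (p \Po ('X + c%:P))`_i = p^`N(i).[c].
Proof.
rewrite /comp_poly addrC nderiv_taylor; last exact: commr_polyX.
rewrite size_map_polyC.
under eq_bigr do rewrite nderivn_map horner_map /= mul_polyC.
rewrite -(poly_def _ (fun i => p^`N(i).[c])) coef_poly.
by case: ltnP => // sz; rewrite nderivn_poly0 // horner0.
Qed.

Lemma dvdp_XnP (F : fieldType) (p : {poly F}) (N : nat) :
  (forall i, (i < N)%N -> p`_i = 0) -> 'X^N %| p.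
Proof.
move=> p0; rewrite -[p](poly_take_drop N) dvdp_addr ?dvdp_mull //.
have -> : take_poly N p = 0; last exact: dvdp0.
by apply/polyP => i; rewrite coef_take_poly coef0; case: ifP => // /p0.
Qed.

(** * The explicit formula as Hermite interpolation *)

Section Interpolation.

Variables (F : fieldType) (n m : nat) (lambda : 'I_n -> F).
Hypothesis lambda_inj : injective lambda.
Hypothesis fact_neq0 : (m.-1)`!%:R != 0 :> F.

Local Notation L := (Lpoly m lambda).
Local Notation Lambda := (Lambda_mx m lambda).

Lemma factr_neq0 (i : nat) : (i < m)%N -> i`!%:R != 0 :> F.
Proof.
move=> im; have i_le : (i <= m.-1)%N by rewrite -ltnS (ltn_predK im).
have : (i`! %| (m.-1)`!)%N by rewrite -(bin_fact i_le) mulnCA dvdn_mulr.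
case/dvdnP=> c E; move: fact_neq0; rewrite E natrM mulf_eq0 negb_or.
by case/andP.
Qed.

Lemma Lpoly_root (l : 'I_n) : (L l).[lambda l] = 1.
Proof.
rewrite horner_prod big1 // => i il; rewrite hornerZ horner_exp hornerXsubC mulVf //.
by rewrite expf_neq0 // subr_eq0; apply: contra_neq il => /lambda_inj.
Qed.

Lemma Lpoly_dvd (l j : 'I_n) : j != l -> ('X - (lambda j)%:P) ^+ m %| L l.
Proof.
by move=> jl; rewrite /Lpoly (bigD1 j) //= -scalerAl -mul_polyC dvdp_mull ?dvdp_mulr.
Qed.

(** The matrix is lower triangular with diagonal entries [(L l).[lambda l] = 1]. *)
Lemma Lambda_unit (l : 'I_n) : Lambda l \in unitmx.
Proof.
rewrite unitmxE det_trig; last first.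
  by apply/is_trig_mxP => i j ij; rewrite mxE leqNgt ij.
rewrite big1 ?unitr1 // => i _.
by rewrite mxE leqnn binn subnn derivn0 Lpoly_root mulr1.
Qed.

Lemma size_Lpoly (l : 'I_n) : (size (L l) <= (n.-1 * m).+1)%N.
Proof.
apply: leq_trans (size_poly_prod_leq _ _) _.
rewrite leq_subLR.
have -> : (#|[pred i : 'I_n | i != l]| = n.-1)%N.
  by have := cardC1 l; rewrite card_ord.
apply: leq_trans (_ : (\sum_(i < n | i != l) m.+1).+1 <= _)%N.
  rewrite ltnS leq_sum // => i _.
  by rewrite (leq_trans (size_scale_leq _ _)) // size_exp_XsubC.
rewrite sum_nat_const; have -> : (#|[pred i : 'I_n | i != l]| = n.-1)%N.
  by have := cardC1 l; rewrite card_ord.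
by rewrite mulnS addnS.
Qed.

(** The entries of [c l] are the derivatives at [lambda l] of the cofactor of [L l] in the summand
    [q l]. *)
Let c (l : 'I_n) : 'cV[F]_m := invmx (Lambda l) *m A_col m lambda l.
Let q (l : 'I_n) : {poly F} :=
  (\sum_(i < m) (i`!%:R^-1 * c l i 0) *: ('X - (lambda l)%:P) ^+ i) * L l.

Lemma rpolyE : rpoly m lambda = \sum_l q l.
Proof.
apply: eq_bigr => l _; rewrite -mulmxA -map_mxM mxE /q mulr_suml.
apply: eq_bigr => i _; rewrite !mxE [_ * _%:P]mulrC mul_polyC.
by rewrite -!scalerAl scalerA mulrC.
Qed.

Lemma size_rpoly : (size (rpoly m lambda) <= n * m)%N.
Proof.
rewrite rpolyE; apply: (big_ind (fun p : {poly F} => (size p <= n * m)%N)).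
- by rewrite size_poly0.
- move=> u v szu szv; apply: leq_trans (size_polyD _ _) _.
  by rewrite geq_max szu.
move=> l _; rewrite /q.
have [m0|m0] := posnP m.
  rewrite big1 ?mul0r ?size_poly0 // => i _.
  by have := leq_trans (ltn_ord i) (eq_leq m0).
apply: leq_trans (size_polyMleq _ _) _.
have sz1 : (size (\sum_(i < m) (i`!%:R^-1 * c l i 0) *:
    ('X - (lambda l)%:P) ^+ i)%R <= m)%N.
  apply: leq_trans (size_sum _ _ _) _; apply/bigmax_leqP => i _.
  by rewrite (leq_trans (size_scale_leq _ _)) // size_exp_XsubC.
have n0 : (0 < n)%N by apply: leq_ltn_trans (leq0n l) (ltn_ord l).
have := leq_add sz1 (size_Lpoly l).
by rewrite addnS -mulSn prednK // => /(leq_sub2r 1); rewrite subn1 subn1.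
Qed.

(* Writing L l = \sum_s b_s (X - lambda l)^s, the entries of Lambda are
   (t! / j!) b_(t-j): Lambda maps the vector c l to the derivatives of q l
   at lambda l. *)
Lemma qpoly_mod (l : 'I_n) :
  ('X - (lambda l)%:P) ^+ m %| q l - (lambda l)%:P.
Proof.
have XE : ('X - (lambda l)%:P) ^+ m = 'X^m \Po ('X - (lambda l)%:P).
  by rewrite comp_Xn_poly.
(* Translating [lambda l] to 0 reduces the claim to the vanishing of the first [m] coefficients. *)
rewrite XE -[q l - _](comp_polyXaddC_K _ (lambda l)) dvdp_comp_poly //.
apply: dvdp_XnP => t tm.
rewrite comp_polyB comp_polyC coefB coefC; apply/eqP; rewrite subr_eq0.
apply/eqP; apply: (mulfI (factr_neq0 tm)).
have := congr1 (fun M : 'cV[F]_m => M (Ordinal tm) 0)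
  (mulKVmx (Lambda_unit l) (A_col m lambda l)).
rewrite -/(c l) [in RHS]mxE /=.
have -> : t`!%:R * (if t == 0%N then lambda l else 0) =
    (if t == 0%N then lambda l else 0) :> F.
  by case: t tm => [|t] _ /=; rewrite ?mul1r ?mulr0.
move=> <-; rewrite mxE /q comp_polyM rmorph_sum mulr_suml coef_sum mulr_sumr.
apply: eq_bigr => j _; rewrite !mxE /=.
rewrite comp_polyZ rmorphXn /= comp_polyB comp_polyX comp_polyC addrK.
rewrite -scalerAl coefZ coefXnM; case: ltnP => jt; first by rewrite !mulr0 mul0r.
(* The terms agree because ['C(t, j) * (j! * (t - j)!) = t!] and [j!] is invertible. *)
rewrite nderivn_def coef_comp_XaddC hornerMn -mulr_natl.
rewrite -(bin_fact jt) !natrM; have := factr_neq0 (ltn_ord j).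
by move=> j0; field.
Qed.

Lemma rpoly_mod (l : 'I_n) :
  ('X - (lambda l)%:P) ^+ m %| rpoly m lambda - (lambda l)%:P.
Proof.
rewrite rpolyE (bigD1 l) //= addrAC dvdp_add ?qpoly_mod //.
elim/big_ind: _ => [|u v|j jl]; [exact: dvdp0 | exact: dvdp_add | ].
by rewrite dvdp_mull // Lpoly_dvd // eq_sym.
Qed.

(** Chinese remainder uniqueness: the difference is divisible by a product of degree [n * m], which
    exceeds its own degree. *)
Lemma rpoly_unique (r : {poly F}) : (size r <= n * m)%N ->
  (forall l, ('X - (lambda l)%:P) ^+ m %| r - (lambda l)%:P) ->
  r = rpoly m lambda.
Proof.
move=> szr rl; apply/eqP; rewrite -subr_eq0; apply/negPn/negP => nz.
have : \prod_l ('X - (lambda l)%:P) ^+ m %| r - rpoly m lambda.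
  apply: coprime_prod_dvdp => [i j ij|l].
    rewrite coprimep_expl // coprimep_expr // coprimep_XsubC root_XsubC.
    by apply: contra_neq ij => /lambda_inj.
  have -> : r - rpoly m lambda =
      (r - (lambda l)%:P) - (rpoly m lambda - (lambda l)%:P).
    by rewrite opprB addrA subrK.
  by rewrite dvdp_sub // rpoly_mod.
move/(dvdp_leq nz); rewrite leqNgt prodrXl.
have -> : size ((\prod_l ('X - (lambda l)%:P)) ^+ m) = (n * m).+1.
  have mon : \prod_(l < n) ('X - (lambda l)%:P) \is monic.
    by apply: monic_prod => i _; apply: monicXsubC.
  rewrite -[LHS]prednK ?size_poly_gt0 ?expf_neq0 ?monic_neq0 //.
  by rewrite size_exp size_prod_XsubC -[in RHS](card_ord n) cardE enumT.
by rewrite ltnS (leq_trans (size_polyD _ _)) // size_polyN geq_max szr size_rpoly.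
Qed.

End Interpolation.

(** * Descent of the formula to [k] and the Jordan decomposition *)

Theorem theorem4p2 (k : fieldType) (k_perfect : perfect_field k)
    (kbar : closedFieldType) (iota : {rmorphism k -> kbar})
    (kbar_closure : is_algebraic_closure iota)
    (A : algType k) (a : A) (a_alg : algebraic_elt a)
    (p : {poly k}) (p_min : is_minimal_poly a p)
    (n : nat) (lambda : 'I_n -> kbar) (lambda_inj : injective lambda)
    (lambda_roots : forall x : kbar,
      root (map_poly iota p) x <-> exists i : 'I_n, x = lambda i)
    (mult : 'I_n -> nat)
    (multE : forall i : 'I_n, mult i = mup (lambda i) (map_poly iota p))
    (m : nat) (mE : m = (\max_(i < n) mult i)%N)
    (fact_neq0 : (m.-1)`!%:R != 0 :> k) :
  exists r : {poly k},
    map_poly iota r = rpoly m lambda /\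
    forall s : A, is_semisimple_part a s <-> s = horner_alg a r.
Proof.
have [p_monic pa0 _] := p_min; have p_neq0 := monic_neq0 p_monic.
have P_neq0 : map_poly iota p != 0 by rewrite map_poly_eq0.
have [p0 [N [sep_p0 p0p pN]]] := perfect_radical k_perfect p_neq0.
have sep_P0 : separable_poly (map_poly iota p0) by rewrite separable_map.
have root_P0 x : root (map_poly iota p) x -> root (map_poly iota p0) x.
  move: pN; rewrite -(dvdp_map iota) rmorphXn /= -!dvdp_XsubCl.
  move=> PN /dvdp_trans/(_ PN); rewrite !dvdp_XsubCl !rootE horner_exp.
  by rewrite expf_eq0 => /andP[].
have mult_le x M : ('X - x%:P) ^+ M.+1 %| map_poly iota p ->
    (exists l, x = lambda l) /\ (M.+1 <= m)%N.
  move=> dvdP; have /lambda_roots[l xl] : root (map_poly iota p) x.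
    by rewrite -dvdp_XsubCl (dvdp_trans _ dvdP) // dvdp_exp.
  split; first by exists l.
  rewrite mE (leq_trans _ (leq_bigmax l)) // multE mup_geq //.
  by rewrite -xl.
(* A constant [p] would force [1 = 0] in [A], so [p] has a root. *)
have m_gt0 : (0 < m)%N.
  have sz_p : size (map_poly iota p) != 1%N.
    rewrite size_map_poly; apply: contraNneq (oner_neq0 A) => /eqP.
    rewrite -dvdp1 => p1.
    by have := horner_alg_dvd pa0 p1; rewrite rmorph1 => /eqP.
  have [x] := closed_rootP _ sz_p; rewrite -dvdp_XsubCl -['X - _]expr1.
  by case/mult_le.
(* The exponent [N] is sharpened to [m] by checking each primary factor. *)
have pm : p %| p0 ^+ m.
  rewrite -(dvdp_map iota); apply: dvdp_local => // x M dvdP.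
  have [[l xl] leMm] := mult_le _ _ dvdP.
  apply: dvdp_trans (dvdp_exp2l _ leMm) _; rewrite rmorphXn /= dvdp_exp2r //.
  by rewrite dvdp_XsubCl root_P0 //; apply/lambda_roots; exists l.
have p0m_neq0 : p0 ^+ m != 0 by rewrite expf_neq0 // separable_poly_neq0.
(* Reduction modulo [p0 ^+ m] keeps both congruences, the first because [m > 0]. *)
have [r [rX rm szr]] : exists r,
    [/\ p0 %| r - 'X, p0 ^+ m %| (p0 \Po r) & (size r < size (p0 ^+ m))%N].
  have [r [rX rm]] := separable_hensel m sep_p0.
  have rr : p0 ^+ m %| r %% (p0 ^+ m) - r.
    by rewrite {2}(divp_eq r (p0 ^+ m)) opprD addrCA subrr addr0 dvdpNr dvdp_mull.
  exists (r %% (p0 ^+ m)); split; last by rewrite ltn_modp.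
    rewrite -(subrK r (_ %% _)) -addrA dvdp_add // (dvdp_trans _ rr) //.
    exact: dvdp_exp.
  rewrite -(subrK (p0 \Po r) (p0 \Po _)) dvdp_add //.
  exact: dvdp_trans rr (comp_polyB_dvd _ _ _).
have r_mod l : ('X - (lambda l)%:P) ^+ m %| map_poly iota r - (lambda l)%:P.
  have root_l : root (map_poly iota p0) (lambda l).
    by apply/root_P0/lambda_roots; exists l.
  have {2}<- : (map_poly iota r).[lambda l] = lambda l.
    apply/eqP; rewrite -subr_eq0 -[X in _ - X]hornerX -hornerN -hornerD -rootE.
    move: rX; rewrite -(dvdp_map iota) rmorphB /= map_polyX -!dvdp_XsubCl.
    by apply: dvdp_trans; rewrite dvdp_XsubCl.
  apply: (separable_comp_dvd sep_P0).
  apply: (@dvdp_trans _ (map_poly iota (p0 ^+ m))).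
    by rewrite rmorphXn dvdp_exp2r // dvdp_XsubCl.
  by rewrite -map_comp_poly dvdp_map.
exists r; split.
  apply: rpoly_unique => //; first by rewrite -(rmorph_nat iota) fmorph_eq0.
  rewrite size_map_poly -ltnS; apply: leq_trans szr _.
  apply: leq_trans (size_poly_exp_leq _ _) _; rewrite ltnS leq_mul2r.
  apply/orP; right; rewrite -ltnS.
  (* This bounds the degree of [p0] by [n]; it holds because [p0] has only simple roots, all among
     the [lambda l]. *)
  suff : map_poly iota p0 %| \prod_l ('X - (lambda l)%:P).
    move/dvdp_leq; rewrite monic_neq0 ?monic_prod // => [/(_ isT)|i _]; last first.
      exact: monicXsubC.
    rewrite size_map_poly size_prod_XsubC -[index_enum _]enumT -cardE card_ord.
    by case: (size p0).
  apply: dvdp_local => [|x [|M] dvdP0]; first exact: separable_poly_neq0.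
    have /lambda_roots[l ->] : root (map_poly iota p) x.
      by rewrite -dvdp_XsubCl (dvdp_trans dvdP0) // dvdp_map.
    by rewrite (bigD1 l) //= dvdp_mulr.
  have := separable_nosquare sep_P0 (isT : (1 < M.+2)%N).
  by move=> /(_ ('X - x%:P)); rewrite size_XsubC dvdP0 => /(_ isT).
move=> s; split=> [[t [[f sE] _ aE [q q_min sep_q] [d td0]]] | ->].
  have qf : p %| (q \Po f).
    apply: (minimal_poly_dvd p_min); rewrite horner_alg_comp -sE.
    by case: q_min.
  have fX : p %| ('X - f) ^+ d.
    apply: (minimal_poly_dvd p_min).
    by rewrite rmorphXn rmorphB /= horner_algX -sE {1}aE addrC addKr.
  apply/eqP; rewrite sE -subr_eq0 -rmorphB; apply/eqP.
  apply: horner_alg_dvd pa0 _.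
  (* Uniqueness: modulo each primary factor of [p] at [x], both [f] and [r] are congruent to [x]. *)
  rewrite -(dvdp_map iota); apply: dvdp_local => // x M dvdP.
  have [[l xl] leMm] := mult_le _ _ dvdP.
  have -> : map_poly iota (f - r) =
      (map_poly iota f - x%:P) - (map_poly iota r - x%:P).
    by rewrite rmorphB opprB addrA subrK.
  apply: dvdp_sub; last first.
    by apply: dvdp_trans (dvdp_exp2l _ leMm) _; rewrite xl r_mod.
  (* Nilpotency of [t] fixes the value of [f] at [x]; separability of [q] then lifts this to the
     full power. *)
  have {2}<- : (map_poly iota f).[x] = x.
    have : root (map_poly iota (('X - f) ^+ d)) x.
      rewrite -dvdp_XsubCl (@dvdp_trans _ (map_poly iota p)) ?dvdp_map //.
      by rewrite (dvdp_trans _ dvdP) // dvdp_exp.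
    rewrite rootE rmorphXn rmorphB /= map_polyX horner_exp expf_eq0 !hornerE.
    by rewrite subr_eq0 => /andP[_ /eqP].
  apply: (@separable_comp_dvd _ (map_poly iota q)); first by rewrite separable_map.
  by rewrite -map_comp_poly (dvdp_trans dvdP) // dvdp_map.
(* Existence: the minimal polynomial of [horner_alg a r] divides the separable [p0]. *)
have p0r : horner_alg (horner_alg a r) p0 = 0.
  by rewrite -horner_alg_comp (horner_alg_dvd pa0) // (dvdp_trans pm).
have [q q_min] : exists q, is_minimal_poly (horner_alg a r) q.
  apply: minimal_poly_exists; exists p0 => //; exact: separable_poly_neq0.
exists (a - horner_alg a r); split.
- by exists r.
- by exists ('X - r); rewrite rmorphB /= horner_algX.
- by rewrite addrC subrK.
- by exists q => //; apply: dvdp_separable sep_p0; apply: minimal_poly_dvd p0r.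
(* Nilpotency: [p] divides [p0 ^+ m], which divides [('X - r) ^+ m]. *)
exists m; rewrite -{1}(horner_algX a) -rmorphB -rmorphXn.
apply: (horner_alg_dvd pa0); rewrite (dvdp_trans pm) // dvdp_exp2r //.
by rewrite -dvdpNr opprB.
Qed.
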